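(* For $N\ge1$ let $\tau_N$ denote the first time the alternating-wells random walk with parameter $\theta$, started at $0$, hits the target set $\{-2N,2N\}$. Then, for any $\theta\in(0,1)\setminus\{1/2\}$, the random variable $$\frac{\tau_N}{\mathbb E_{0,\delta_\theta}[\tau_N]}$$ converges in distribution (under $\mathbb P_{0,\delta_\theta}$), as $N\to\infty$, to an exponential random variable with parameter $1$.
   Context: Alternating-wells random walk with parameter $\theta$ (depending on $N\ge1$): the nearest-neighbour Markov chain on $\mathcal X_N=\{-2N,\dots,2N\}$ with transition probabilities $Q_N^{(\theta)}(x,x+1)=\theta$, $Q_N^{(\theta)}(x,x-1)=1-\theta$ for integers $x\in[-2N+1,-N-1]\cup[N+1,2N-1]$, and $Q_N^{(\theta)}(x,x+1)=1-\theta$, $Q_N^{(\theta)}(x,x-1)=\theta$ for integers $x\in[-N,N]$, except that at the target points $\pm2N$ the transition probabilities are arbitrary (irrelevant); in particular when $N=1$ the points $\pm 1$ follow the second rule. $\mathbb P_{0,\delta_\theta}$ and $\mathbb E_{0,\delta_\theta}$ denote probability and expectation for the walk with parameter $\theta$ started at $0$. *)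

(* Defs.v *)
From mathcomp Require Export all_boot all_order all_algebra.
From mathcomp Require Export all_classical all_reals all_analysis.
Export Order.TTheory GRing.Theory Num.Theory.
Export numFieldNormedType.Exports.

#[export] Set Implicit Arguments.
#[export] Unset Strict Implicit.
#[export] Unset Printing Implicit Defensive.

Local Open Scope classical_set_scope.
Local Open Scope ring_scope.

Definition stochastic_matrix (R : realType) (S : finType) (Q : S -> S -> R) :=
  (forall x y, 0 <= Q x y) /\ (forall x, \sum_(y : S) Q x y = 1).

(* The one-step condition is the Markov property
   P(X_{n+1} = y | X_0 = h 0, ..., X_n = h n) = Q (h n) y,
   multiplied out so that it also makes sense for histories of probability
   zero. *)
Definition markov_chain_from (R : realType) (d : measure_display)
    (T : measurableType d) (P : probability T R) (S : finType)
    (Q : S -> S -> R) (x0 : S) (X : nat -> T -> S) :=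
  [/\ forall n x, measurable [set w | X n w = x],
      P [set w | X 0%N w = x0] = 1%E &
      forall n (h : nat -> S) (y : S),
        P [set w | (forall k, (k <= n)%N -> X k w = h k) /\ X n.+1 w = y] =
        (P [set w | forall k, (k <= n)%N -> X k w = h k] * (Q (h n) y)%:E)%E].

(* Takes the value +oo on trajectories that never visit A. *)
Definition hitting_time (R : realType) (T : Type) (S : finType)
    (X : nat -> T -> S) (A : {set S}) (w : T) : \bar R :=
  ereal_inf [set n%:R%:E | n in [set n | X n w \in A]].

(* Convergence of distribution functions at the continuity points of the
   distribution function of mu, i.e. the points that are not atoms of mu.
   The variables may live on different probability spaces. *)
Definition cvg_in_distribution (R : realType) (d : nat -> measure_display)
    (T : forall n, measurableType (d n)) (P : forall n, probability (T n) R)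
    (Y : forall n, T n -> \bar R) (mu : probability (measurableTypeR R) R) :=
  forall t : R, mu [set t] = 0%E ->
    P n [set w | (Y n w <= t%:E)%E] @[n --> \oo] --> mu `]-oo, t]%classic.

Definition std_exponential (R : realType) : probability (measurableTypeR R) R.
Proof.
by unshelve refine (exponential_prob 1 : probability _ R); exact: ltr01.
Defined.

Lemma std_exponentialE (R : realType) (A : set R) :
  std_exponential R A = exponential_prob 1 A.
Proof. by []. Qed.

(* The ordinal i : 'I_(4N+1) stands for the site i - 2N of {-2N, ..., 2N}. *)
Definition state (N : nat) := 'I_(4 * N).+1.

Definition site (N : nat) (x : state N) : int := (x : nat)%:Z - (2 * N)%:Z.

Definition origin (N : nat) : state N := inord (2 * N).

Lemma site_origin (N : nat) : site (origin N) = 0.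
Proof. by rewrite /site inordK ?subrr // ltnS leq_mul2r orbT. Qed.

Lemma site_inj (N : nat) : injective (@site N).
Proof. by move=> x y /addIr [] /val_inj. Qed.

Definition target (N : nat) : {set state N} :=
  finset (fun x : state N => `|site x| == (2 * N)%:Z).

Definition up_prob (R : realType) (theta : R) (N : nat) (x : int) : R :=
  if `|x| <= N%:Z then 1 - theta else theta.

(* The rows of Q at the two target points are left unconstrained, apart from
   being probability vectors. *)
Definition alternating_wells (R : realType) (theta : R) (N : nat)
    (Q : state N -> state N -> R) :=
  stochastic_matrix Q /\
  forall x y : state N, x \notin target N ->
    Q x y = if site y == site x + 1 then up_prob theta N (site x)
            else if site y == site x - 1 then 1 - up_prob theta N (site x)
            else 0.

(* Main.v *)
Require Import Defs.
From mathcomp Require Import measurable_realfun zify ring lra.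

Local Open Scope classical_set_scope.
Local Open Scope ring_scope.

(** In both wells the drift has the same strength, and the reflection
    [x |-> - x] exchanges [theta] with [1 - theta], so one may picture
    [theta < 1/2]. Started at 0, the walk is pushed to the site [N], the bottom
    of a well whose rim is the target [2N], at height [N]; the other way out
    first climbs from [N] to [-N], at height [2N], and is negligible. Each
    attempt to reach the rim from the bottom succeeds with a probability of
    order [r ^+ N], where [r < 1] is the ratio of the two jump probabilities,
    and the attempts are nearly independent; hence the exponential law.

    The proof replaces independence by two explicit test functions of the
    distance [j] to the target at the rim of the well. Let [S n] be the
    probability of not having hit the target up to time [n], and let [scale]
    be the leading order of the mean hitting time.

    - [upper_barrier] satisfies [Q U <= U - 1] off the target and [U >= 0].
      Optional stopping gives [\sum_n S n <= U(origin) <= scale]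
      ([survival_sum_le]).

    - [lower_barrier] satisfies [Q h >= (1 - rate) h] off the target, [h <= 1],
      [h <= 0] on the target, [h(origin)] close to 1 and [rate] close to
      [1 / scale]. Optional stopping gives
      [S n >= h(origin) (1 - rate) ^+ n] ([survival_ge]).

    No test function gives an upper bound [S n <= C (1 - rate) ^+ n] with [C]
    near 1: it would have to be at least 1 also next to the target, which the
    walk reaches at a rate comparable to [1 / scale], and this would push its
    value at the origin above 1 by a fixed amount. The upper bound comes instead
    from a Scheffe type argument ([survival_cvg_expR]): the geometric lower
    bound already has total mass close to [scale], which is the most that [S]
    can have, so their difference has mass negligible with respect to [scale];
    as [S] is nonincreasing, they are close pointwise. The same computation
    shows that the mean hitting time, which is [\sum_n S n], is asymptotic to
    [scale]. *)

(** * Exponential limits from a geometric lower bound of the right mass *)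

Section Survival.
Context {R : realType}.

Lemma geometric_mass_le (s : nat -> R) (m e K : R) :
  0 < e -> e < 1 -> 1 + e < K ->
  series s @ \oo --> m ->
  (forall i, (1 - e) * (1 - (1 + e) / K) ^+ i <= s i) ->
  (1 - e) / (1 + e) * K <= m.
Proof.
move=> e0 e1 K1 sm ls.
have K0 : 0 < K by lra.
have x01 : 0 < (1 + e) / K < 1.
  by apply/andP; split; [apply: divr_gt0 => //; lra | rewrite ltr_pdivrMr ?mul1r].
have z1 : `|1 - (1 + e) / K| < 1 by rewrite ger0_norm; lra.
have /= gm := @cvg_geometric_series R (1 - e) _ z1.
have -> : (1 - e) / (1 + e) * K = (1 - e) * (1 - (1 - (1 + e) / K))^-1.
  by field; do ?[apply/andP; split]; apply/eqP; lra.
apply: ler_cvg_to gm sm _ => /=.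
by apply: nearW => n; rewrite ler_sum// => i _; exact: ls.
Qed.

(** On the window of length [k] that ends at [n], [s] stays above [s n] and the
    geometric bound stays below its value at [n - k]. Summed over the window,
    the excess of the former over the latter is at most the total excess mass,
    which is of order [e * K]. *)
Lemma survival_le (s : nat -> R) (m e K : R) (n k : nat) :
  0 < e -> e < 1 -> 1 + e < K ->
  {homo s : i j / (i <= j)%N >-> j <= i} ->
  series s @ \oo --> m -> m <= K ->
  (forall i, (1 - e) * (1 - (1 + e) / K) ^+ i <= s i) ->
  (k <= n)%N ->
  k%:R * s n <= 2 * e * K + k%:R * (1 - (1 + e) / K) ^+ (n - k).
Proof.
move=> e0 e1 K1 sdec sm mK ls kn.
have K0 : 0 < K by lra.
have x01 : 0 < (1 + e) / K < 1.
  by apply/andP; split; [apply: divr_gt0 => //; lra | rewrite ltr_pdivrMr ?mul1r].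
set z := 1 - (1 + e) / K in ls *.
have z01 : 0 < z < 1 by rewrite /z; lra.
have z1 : `|z| < 1 by rewrite ger0_norm; lra.
have gm := @cvg_geometric_series R (1 - e) _ z1.
have dm := cvgB sm gm.
have : k%:R * (s n - z ^+ (n - k)) <= m - (1 - e) * (1 - z)^-1.
  refine (@ler_cvg_to _ \oo _ R (cst (k%:R * (s n - z ^+ (n - k)))) _ _ _
    (cvg_cst _) (dm _) _).
  exists n => //= L /= nL; rewrite !fctE /series /= -sumrB.
  have sub i : (0 <= s i - geometric (1 - e) z i) by rewrite subr_ge0; exact: ls.
  rewrite (big_cat_nat (n := n - k))//=; last first.
    exact: leq_trans (leq_subr _ _) nL.
  rewrite (big_cat_nat (n := n) (m := n - k))//= ?leq_subr//.
  apply: (@le_trans _ _ (\sum_(n - k <= i < n) (s i - geometric (1 - e) z i))).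
    rewrite mulr_natl -[X in _ *+ X](subKn kn) -sumr_const_nat.
    apply: ler_sum_nat => i /andP[ki i_n].
    apply: lerB; first exact/sdec/ltnW.
    apply: (@le_trans _ _ (z ^+ i)).
      by rewrite /geometric /= ler_piMl//; [apply: exprn_ge0; lra | lra].
    by apply: ler_wiXn2l => //; lra.
  by rewrite addrCA lerDl addr_ge0//; apply: sumr_ge0 => i _; exact: sub.
have -> : (1 - e) * (1 - z)^-1 = (1 - e) / (1 + e) * K.
  by rewrite /z; field; do ?[apply/andP; split]; apply/eqP; lra.
rewrite mulrBr lerBlDr => /le_trans; apply; rewrite lerD2r.
have : (1 - 2 * e) * K <= (1 - e) / (1 + e) * K.
  rewrite ler_pM2r// ler_pdivlMr; last by lra.
  nra.
lra.
Qed.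

Lemma exprn_le_expR (x : R) (n : nat) : x <= 1 ->
  (1 - x) ^+ n <= expR (- (x * n%:R)).
Proof.
move=> x1; rewrite [_ * n%:R]mulrC -mulrN expRM_natl.
by apply: lerXn2r; rewrite ?nnegrE ?expR_ge0 ?subr_ge0// expR_ge1Dx.
Qed.

Lemma expR_le_exprn (x : R) (n : nat) : x < 1 ->
  expR (- (x / (1 - x) * n%:R)) <= (1 - x) ^+ n.
Proof.
move=> x1; rewrite [_ * n%:R]mulrC -mulrN expRM_natl.
apply: lerXn2r; rewrite ?nnegrE ?expR_ge0//; first by lra.
rewrite expRN invf_ple ?posrE ?expR_gt0//; last by lra.
apply: le_trans (expR_ge1Dx _).
by rewrite le_eqVlt; apply/orP; left; apply/eqP; field; apply/eqP; lra.
Qed.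

(** With a window of length [z * K N] and [e := z ^+ 2], [survival_le] bounds
    [S N n] by a term of order [e / z = z] plus the geometric bound shifted by
    [z] in the rescaled time. The functions [F] and [G] below collect the
    resulting upper and lower bounds on the limit; both tend to [expR (- t)] as
    [z] tends to 0. *)
Lemma survival_cvg_expR (S : nat -> nat -> R) (K m : nat -> R) :
  (\forall N \near \oo, {homo S N : i j / (i <= j)%N >-> j <= i}) ->
  (\forall N \near \oo, S N 0 <= 1) ->
  (\forall N \near \oo, series (S N) @ \oo --> m N) ->
  (\forall N \near \oo, m N <= K N) ->
  K @ \oo --> +oo ->
  (forall e, 0 < e -> e < 1 -> \forall N \near \oo, forall i,
     (1 - e) * (1 - (1 + e) / K N) ^+ i <= S N i) ->
  forall t, 0 <= t -> S N (Num.trunc (t * m N)) @[N --> \oo] --> expR (- t).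
Proof.
move=> Sdec S1 Sm mK Ky lowS t t0.
pose F (z : R) := 2 * z + expR (- t + z + 2 * z ^+ 2 * (t + 1)).
pose G (z : R) := (1 - z) * expR (- ((1 + z) * (1 + z) * t)).
have F0 : F z @[z --> 0^'+] --> expR (- t).
  apply: cvg_at_right_filter.
  have -> : expR (- t) = F 0 by rewrite /F expr0n /= !mulr0 mul0r !addr0 add0r.
  apply: cvgD; first by apply: cvgM; [exact: cvg_cst | exact: cvg_id].
  apply: continuous_comp; last exact: continuous_expR.
  apply: cvgD; first by apply: cvgD; [exact: cvg_cst | exact: cvg_id].
  apply: cvgM; last exact: cvg_cst.
  by apply: cvgM; [exact: cvg_cst | exact: exprn_continuous].
have G0 : G z @[z --> 0^'+] --> expR (- t).
  apply: cvg_at_right_filter.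
  have -> : expR (- t) = G 0.
    by rewrite /G subr0 addr0 !mul1r.
  apply: cvgM; first by apply: cvgB; [exact: cvg_cst | exact: cvg_id].
  apply: continuous_comp; last exact: continuous_expR.
  apply: cvgN; apply: cvgM; last exact: cvg_cst.
  by apply: cvgM; apply: cvgD; [exact: cvg_cst | exact: cvg_id
    | exact: cvg_cst | exact: cvg_id].
apply/cvgrPdistC_le => eps eps0.
have [z [z0 z1 Fz Gz]] : exists z, [/\ 0 < z, z < 1, F z <= expR (- t) + eps
    & expR (- t) - eps <= G z].
  have : \forall z \near 0^'+, [/\ 0 < z, z < 1, F z <= expR (- t) + eps
      & expR (- t) - eps <= G z].
    near=> z; split.
    - by near: z; exact: nbhs_right_gt.
    - by near: z; exact: nbhs_right_lt.
    - by near: z; apply: cvgr_le F0 _ _; rewrite ltrDl.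
    - by near: z; apply: cvgr_ge G0 _ _; rewrite ltrBlDr ltrDl.
  by move=> /filter_ex.
pose e := z ^+ 2.
have e0 : 0 < e by rewrite exprn_gt0.
have e1 : e < 1 by rewrite expr_lt1// ltW.
near=> N.
have dec : {homo S N : i j / (i <= j)%N >-> j <= i} by near: N.
have S1N i : S N i <= 1.
  by apply: (@le_trans _ _ (S N 0)); [exact: dec | near: N].
have SmN : series (S N) @ \oo --> m N by near: N.
have mKN : m N <= K N by near: N.
have Kz : 4 / z <= K N by near: N; exact: (cvgryPge _).1 Ky _.
have Ke : 4 / e <= K N by near: N; exact: (cvgryPge _).1 Ky _.
have lowe : forall i, (1 - e) * (1 - (1 + e) / K N) ^+ i <= S N i.
  by near: N; exact: lowS.
have lowz : forall i, (1 - z) * (1 - (1 + z) / K N) ^+ i <= S N i.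
  by near: N; exact: lowS.
rewrite ler_pdivrMr// in Kz; rewrite ler_pdivrMr// in Ke.
have K4 : 4 < K N by nra.
have m_ge := geometric_mass_le e0 e1 (ltac:(lra) : 1 + e < K N) SmN lowe.
have m_ge' : (1 - 2 * e) * K N <= m N.
  apply: le_trans m_ge; rewrite ler_pM2r; last by lra.
  by rewrite ler_pdivlMr; [nra | lra].
have m0 : 0 <= m N.
  by apply: le_trans m_ge; rewrite !mulr_ge0 ?invr_ge0//; lra.
set n := Num.trunc _.
have /andP[n_le n_gt] : n%:R <= t * m N < n.+1%:R.
  by apply: truncn_itv; exact: mulr_ge0.
rewrite -natr1 in n_gt.
rewrite ler_distl; apply/andP; split.
  apply: le_trans Gz _; apply: le_trans (lowz n); rewrite /G.
  rewrite ler_pM2l; last by lra.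
  have x1 : (1 + z) / K N < 1 by rewrite ltr_pdivrMr; lra.
  apply: le_trans (expR_le_exprn n x1); rewrite ler_expR lerN2.
  have -> : (1 + z) / K N / (1 - (1 + z) / K N) = (1 + z) / (K N - (1 + z)).
    by field; do ?[apply/andP; split]; apply/eqP; lra.
  rewrite mulrAC ler_pdivrMr; last by lra.
  apply: (@le_trans _ _ ((1 + z) * (t * K N))).
    rewrite ler_pM2l; last by lra.
    by apply: le_trans n_le _; rewrite ler_wpM2l.
  have -> : (1 + z) * (1 + z) * t * (K N - (1 + z))
     = ((1 + z) * t) * ((1 + z) * (K N - (1 + z))) by ring.
  rewrite mulrA ler_wpM2l//; first by rewrite mulr_ge0//; lra.
  by nra.
apply: le_trans Fz; rewrite /F.
have zK0 : 0 <= z * K N by rewrite mulr_ge0//; lra.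
pose k := (Num.trunc (z * K N)).+1.
have /andP[k_le k_gt] := truncn_itv zK0; rewrite -/k in k_gt.
have k_leS : k%:R <= z * K N + 1 by rewrite /k -natr1 lerD2r.
have K0 : 0 < K N by lra.
have tm : t * (1 - 2 * e) * K N <= t * m N by rewrite -mulrA ler_wpM2l.
(* For a window longer than n the exponential in F exceeds 1. *)
have [kn|nk] := leqP k n; last first.
  apply: le_trans (S1N n) _.
  suff : 1 <= expR (- t + z + 2 * z ^+ 2 * (t + 1)) by lra.
  rewrite -[leLHS]expR0 ler_expR -/e.
  have nk' : n%:R + 1 <= k%:R :> R by rewrite natr1 ler_nat.
  suff : 0 <= (- t + z + 2 * e * (t + 1)) * K N by rewrite pmulr_lge0.
  by nra.
have k0 : 0 < k%:R :> R by rewrite ltr0n.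
have := survival_le e0 e1 (ltac:(lra) : 1 + e < K N) dec SmN mKN lowe kn.
rewrite -ler_pdivlMl// mulrDr mulKf ?gt_eqF// => /le_trans; apply.
apply: lerD.
  by rewrite mulrC ler_pdivrMr//; rewrite /e; nra.
have x1 : (1 + e) / K N <= 1 by rewrite ler_pdivrMr; lra.
apply: le_trans (exprn_le_expR _ x1) _.
rewrite ler_expR -/e natrB//.
suff : (- (- t + z + 2 * e * (t + 1))) * K N <= n%:R - k%:R.
  rewrite -ler_pdivlMr// => h.
  rewrite lerNl; apply: le_trans h _.
  rewrite mulrAC ler_pM2r ?invr_gt0//.
  have : k%:R <= n%:R :> R by rewrite ler_nat.
  by nra.
by nra.
Unshelve. all: by end_near. Qed.
End Survival.

(** * The chain killed at its target *)

Section Killed.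
Context {R : realType} {d : measure_display} {T : measurableType d}.
Variable P : probability T R.

Lemma probability_partition (I : finType) (Z : T -> I) (E : set T) :
  measurable E -> (forall i, measurable [set w | Z w = i]) ->
  P E = (\sum_(i : I) P (E `&` [set w | Z w = i]))%E.
Proof.
move=> mE mZ.
have -> : (\sum_(i : I) P (E `&` [set w | Z w = i]))%E =
    (\sum_(i \in [set: I]) P (E `&` [set w | Z w = i]))%E.
  symmetry; apply: fsbig_fwiden; rewrite ?index_enum_uniq//.
  - by move=> i _ /=; exact: mem_index_enum.
  - by move=> i [_ /=]; rewrite /not => /(_ Logic.I).
rewrite -measure_fin_bigcup; [| exact: finite_finset | |].
- by congr (P _); apply/seteqP; split => [w Ew|w [i _ []]//]; exists (Z w).
- by move=> i j _ _ [w [[_ <-] [_ <-]]].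
- by move=> i _; exact: measurableI.
Qed.

Variables (S : finType) (Q : S -> S -> R) (x0 : S) (X : nat -> T -> S).
Hypothesis XQ : markov_chain_from P Q x0 X.

Lemma measurable_state_event n (B : pred S) : measurable [set w | B (X n w)].
Proof.
have [mX _ _] := XQ.
have -> : [set w | B (X n w)] = \bigcup_(x in [set x | B x]) [set w | X n w = x].
  by apply/seteqP; split => [w Bw|w [x Bx /= ->//]]; exists (X n w).
by apply: fin_bigcup_measurable; [exact: finite_finset | move=> x _; exact: mX].
Qed.

Lemma measurable_history (B : nat -> pred S) n :
  measurable [set w | forall k, (k <= n)%N -> B k (X k w)].
Proof.
have -> : [set w | forall k, (k <= n)%N -> B k (X k w)] =
    \bigcap_(k in [set k | (k <= n)%N]) [set w | B k (X k w)].
  by [].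
apply: bigcap_measurable; last by move=> k _; exact: measurable_state_event.
by exists 0%N.
Qed.

(** The Markov property is assumed for one complete history at a time;
    summing over the finitely many histories allowed by [B] gives it for an
    event of the past. *)
Lemma markov_step n (B : nat -> pred S) x y :
  P [set w | (forall k, (k <= n)%N -> B k (X k w)) /\ X n w = x /\ X n.+1 w = y]
  = (P [set w | (forall k, (k <= n)%N -> B k (X k w)) /\ X n w = x]
     * (Q x y)%:E)%E.
Proof.
have [mX _ step] := XQ.
pose Z w : {ffun 'I_n.+1 -> S} := [ffun k : 'I_n.+1 => X k w].
have ZE w h : Z w = h <-> forall k, (k <= n)%N -> X k w = h (inord k).
  split=> [<- k kn|Xh]; first by rewrite ffunE inordK.
  by apply/ffunP => k; rewrite ffunE Xh ?inord_val// -ltnS.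
have mZ h : measurable [set w | Z w = h].
  have -> : [set w | Z w = h] =
      [set w | forall k, (k <= n)%N -> pred1 (h (inord k)) (X k w)].
    apply/seteqP; split => w /= => [/ZE Xh k kn|Xh]; first by rewrite Xh ?eqxx.
    by apply/ZE => k /Xh /eqP.
  exact: (measurable_history (fun k => pred1 (h (inord k)))).
have mE : measurable
    [set w | (forall k, (k <= n)%N -> B k (X k w)) /\ X n w = x].
  exact: measurableI (measurable_history B n) (mX n x).
have mE' : measurable [set w | (forall k, (k <= n)%N -> B k (X k w))
    /\ X n w = x /\ X n.+1 w = y].
  exact: measurableI (measurable_history B n)
    (measurableI _ _ (mX n x) (mX n.+1 y)).
rewrite (probability_partition mE' mZ) (probability_partition mE mZ).
rewrite ge0_sume_distrl; last by move=> *; exact: measure_ge0.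
apply: eq_bigr => h _.
have [[Bh hx]|nBh] := pselect ((forall k, (k <= n)%N -> B k (h (inord k)))
    /\ h (inord n) = x).
  have -> : [set w | (forall k, (k <= n)%N -> B k (X k w)) /\ X n w = x]
      `&` [set w | Z w = h] =
      [set w | forall k, (k <= n)%N -> X k w = h (inord k)].
    apply/seteqP; split => w /= => [[_ /ZE]//|Xh]; split; last exact/ZE.
    by split=> [k kn|]; rewrite Xh//; exact: Bh.
  rewrite -hx -(step n (fun k => h (inord k)) y); congr (P _).
  apply/seteqP; split => w /= => [[[_ [_ Xy]] /ZE]//|[Xh Xy]].
  split; last exact/ZE.
  by split=> [k kn|]; rewrite Xh//; exact: Bh.
have empty (E : set T) : E `<=` [set w | (forall k, (k <= n)%N -> B k (X k w))
    /\ X n w = x] -> P (E `&` [set w | Z w = h]) = 0%E.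
  move=> EB; rewrite (_ : _ `&` _ = set0) ?measure0//.
  apply/seteqP; split => w //= [/EB[Bw Xx] /ZE Xh]; apply: nBh; split.
    by move=> k kn; rewrite -Xh//; exact: Bw.
  by rewrite -Xh.
by rewrite !empty ?mul0e// => w [Bw []].
Qed.

Variable A : {set S}.

Definition alive n : set T := [set w | forall k, (k <= n)%N -> X k w \notin A].

(** A sub-probability, whose missing mass is the probability of having been
    absorbed. *)
Definition killed_law n (x : S) : R :=
  fine (P (alive n `&` [set w | X n w = x])).

Definition survival n : R := fine (P (alive n)).

Lemma measurable_alive n : measurable (alive n).
Proof. exact: (measurable_history (fun=> [pred x | x \notin A])). Qed.

Lemma survival_sum n : survival n = \sum_x killed_law n x.
Proof.
have [mX _ _] := XQ.
rewrite /survival (probability_partition (measurable_alive n) (mX n)).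
rewrite -sum_fine// => x _.
exact: fin_num_measure (measurableI _ _ (measurable_alive n) (mX n x)).
Qed.

Lemma killed_law_ge0 n x : 0 <= killed_law n x.
Proof. by rewrite fine_ge0. Qed.

Lemma killed_law_target n x : x \in A -> killed_law n x = 0.
Proof.
move=> xA; rewrite /killed_law (_ : _ `&` _ = set0) ?measure0//.
by apply/seteqP; split => w //= [/(_ n (leqnn n))] /[swap] ->; rewrite xA.
Qed.

Lemma killed_law0 x : x0 \notin A -> killed_law 0 x = (x == x0)%:R.
Proof.
have [mX X0 _] := XQ; move=> x0A; rewrite /killed_law.
have [->|xx0] := eqVneq x x0.
  rewrite (_ : _ `&` _ = [set w | X 0%N w = x0]) ?X0//.
  apply/seteqP; split => w /= => [[]//|Xx0]; split=> // k.
  by rewrite leqn0 => /eqP ->; rewrite Xx0.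
have : P ([set w | X 0%N w = x]) = 0%E.
  apply/eqP; rewrite -measure_le0.
  have : (P [set w | X 0%N w = x0] + P [set w | X 0%N w = x] <= 1)%E.
    rewrite -measureU//; first exact: probability_le1 (measurableU _ _ (mX _ _) (mX _ _)).
    by apply/seteqP; split => w //= [-> xE]; rewrite xE eqxx in xx0.
  by rewrite X0 -[leRHS]adde0 leeD2lE.
move=> Px; rewrite (_ : P _ = 0%E)//; apply/eqP.
rewrite -measure_le0 -Px; apply: le_measure; rewrite ?inE//.
  exact: measurableI (measurable_alive 0) (mX _ _).
Qed.

Lemma killed_law_step n y : y \notin A ->
  killed_law n.+1 y = \sum_x killed_law n x * Q x y.
Proof.
have [mX _ _] := XQ; move=> yA; rewrite /killed_law.
have -> : alive n.+1 `&` [set w | X n.+1 w = y] =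
    alive n `&` [set w | X n.+1 w = y].
  apply/seteqP; split => w /= [Aw Xy]; split=> // k.
    by move=> kn; apply: Aw; exact: leqW.
  by rewrite leq_eqVlt => /predU1P[->|]; [rewrite Xy | rewrite ltnS => /Aw].
rewrite (probability_partition (measurableI _ _ (measurable_alive n) (mX n.+1 y)) (mX n)).
rewrite -sum_fine; last first.
  move=> x _; apply: fin_num_measure.
  exact: measurableI (measurableI _ _ (measurable_alive n) (mX _ _)) (mX n x).
apply: eq_bigr => x _.
have := markov_step n (fun=> [pred x | x \notin A]) x y.
rewrite (_ : [set w | _ /\ _ /\ _] =
  alive n `&` [set w | X n.+1 w = y] `&` [set w | X n w = x]); last first.
  by apply/seteqP; split => w; [move=> [? []] | move=> [[? ?]]].
move=> ->; rewrite fineM//.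
exact: fin_num_measure (measurableI _ _ (measurable_alive n) (mX n x)).
Qed.

Hypothesis Q_ge0 : forall x y, 0 <= Q x y.
Hypothesis x0A : x0 \notin A.

Lemma killed_mean0 (f : S -> R) : \sum_x killed_law 0 x * f x = f x0.
Proof.
rewrite (bigD1 x0)//= killed_law0// eqxx mul1r big1 ?addr0// => x xx0.
by rewrite killed_law0// (negbTE xx0) mul0r.
Qed.

(** Among the transitions out of the surviving mass, those that enter [A] are
    lost, which only decreases the mean when [f] is nonnegative there. *)
Lemma killed_mean_step (f : S -> R) n : (forall y, y \in A -> 0 <= f y) ->
  \sum_y killed_law n.+1 y * f y
    <= \sum_x killed_law n x * \sum_y Q x y * f y.
Proof.
move=> fA.
apply: (@le_trans _ _ (\sum_y (\sum_x killed_law n x * Q x y) * f y)).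
  apply: ler_sum => y _; have [yA|yA] := boolP (y \in A).
    rewrite killed_law_target// mul0r mulr_ge0 ?fA//.
    by apply: sumr_ge0 => x _; rewrite mulr_ge0// killed_law_ge0.
  by rewrite killed_law_step.
under eq_bigr do rewrite mulr_suml.
rewrite exchange_big /=; apply: ler_sum => x _.
by rewrite mulr_sumr ler_sum// => y _; rewrite mulrA.
Qed.

(** The killed mean of [U] decreases by at least [survival n] at time [n] and
    stays nonnegative, so the total decrease is at most its initial value. *)
Lemma survival_sum_le (U : S -> R) L : (forall x, 0 <= U x) ->
  (forall x, x \notin A -> \sum_y Q x y * U y <= U x - 1) ->
  \sum_(0 <= i < L) survival i <= U x0.
Proof.
move=> U0 QU; suff : \sum_(0 <= i < L) survival i
    + \sum_x killed_law L x * U x <= U x0.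
  apply: le_trans; rewrite lerDl; apply: sumr_ge0 => x _.
  by rewrite mulr_ge0// killed_law_ge0.
elim: L => [|L IH]; first by rewrite big_geq// add0r killed_mean0.
apply: le_trans IH; rewrite big_nat_recr//= -addrA lerD2l.
rewrite -lerBrDl; apply: le_trans (killed_mean_step _ (fun y _ => U0 y)) _.
rewrite survival_sum -sumrB; apply: ler_sum => x _.
have [xA|xA] := boolP (x \in A); first by rewrite killed_law_target// !mul0r subr0.
rewrite -[X in _ - X]mulr1 -mulrBr.
by apply: ler_wpM2l; [exact: killed_law_ge0 | exact: QU].
Qed.

(** The killed mean of [h] decreases at most geometrically, and it is at most
    the surviving mass because [h <= 1]. *)
Lemma survival_ge (h : S -> R) (l : R) n : l <= 1 ->
  (forall x, h x <= 1) -> (forall x, x \in A -> h x <= 0) ->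
  (forall x, x \notin A -> (1 - l) * h x <= \sum_y Q x y * h y) ->
  h x0 * (1 - l) ^+ n <= survival n.
Proof.
move=> l1 h1 hA Qh; apply: (@le_trans _ _ (\sum_x killed_law n x * h x)).
  elim: n => [|n IH]; first by rewrite expr0 mulr1 killed_mean0.
  have step : \sum_x killed_law n x * \sum_y Q x y * h y
      <= \sum_y killed_law n.+1 y * h y.
    have := @killed_mean_step (fun x => - h x) n.
    rewrite [leLHS](_ : _ = - \sum_y killed_law n.+1 y * h y); last first.
      by rewrite -sumrN; apply: eq_bigr => y _; rewrite mulrN.
    rewrite [leRHS](_ : _ = - \sum_x killed_law n x * \sum_y Q x y * h y).
      by rewrite lerN2; apply=> y yA; rewrite oppr_ge0 hA.
    rewrite -sumrN; apply: eq_bigr => x _; rewrite -mulrN -sumrN.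
    by congr (_ * _); apply: eq_bigr => y _; rewrite mulrN.
  apply: le_trans step.
  rewrite exprS mulrCA.
  apply: (@le_trans _ _ ((1 - l) * \sum_x killed_law n x * h x)).
    by rewrite ler_wpM2l// subr_ge0.
  rewrite mulr_sumr; apply: ler_sum => x _; rewrite mulrCA.
  have [xA|xA] := boolP (x \in A); first by rewrite killed_law_target// !mul0r.
  by apply: ler_wpM2l; [exact: killed_law_ge0 | exact: Qh].
rewrite survival_sum; apply: ler_sum => x _.
by rewrite ler_piMr// killed_law_ge0.
Qed.

Lemma survival_le1 n : survival n <= 1.
Proof.
rewrite -lee_fin fineK; last exact: fin_num_measure (measurable_alive n).
exact: probability_le1 (measurable_alive n).
Qed.

Lemma survival_nonincreasing : {homo survival : i j / (i <= j)%N >-> j <= i}.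
Proof.
move=> i j ij; apply: fine_le.
- exact: fin_num_measure (measurable_alive j).
- exact: fin_num_measure (measurable_alive i).
apply: le_measure; rewrite ?inE; try exact: measurable_alive.
by move=> w Aw k ki; apply: Aw; exact: leq_trans ij.
Qed.

Local Notation tau := (hitting_time R X A).

Lemma alive_hitting_time n w : alive n w <-> (n%:R%:E < tau w)%E.
Proof.
split=> [Aw|tw k kn].
  apply: (@lt_le_trans _ _ n.+1%:R%:E); first by rewrite lte_fin ltr_nat.
  apply: le_ereal_inf_tmp => _ [k /= Xk <-].
  rewrite lee_fin ler_nat ltnNge; apply/negP => kn.
  by have := Aw k kn; rewrite Xk.
apply/negP => XA; move: tw; apply/negP; rewrite -leNgt.
apply: (@le_trans _ _ k%:R%:E); last by rewrite lee_fin ler_nat.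
by apply: ereal_inf_lbound; exists k.
Qed.

(** The tail-sum formula, pathwise: the hitting time counts the times at
    which the chain is still alive. It also holds, as [+oo = +oo], on a
    trajectory that never hits. *)
Lemma hitting_time_sum w : tau w = (\sum_(0 <= n <oo) (\1_(alive n) w)%:E)%E.
Proof.
have ind_ge0 n : (0 <= (\1_(alive n) w)%:E :> \bar R)%E by rewrite lee_fin.
have [[n Xn]|nX] := pselect (exists n, X n w \in A).
  have [t Xt tmin] := ex_minnP (ex_intro (fun n => X n w \in A) n Xn).
  have aliveE k : \1_(alive k) w = (k < t)%N%:R :> R.
    rewrite indicE; congr (nat_of_bool _)%:R; apply/idP/idP => [|kt].
      rewrite inE => Aw; rewrite ltnNge; apply/negP => tk.
      by have := Aw t tk; rewrite Xt.
    rewrite inE => j jk; apply/negP => /tmin; rewrite leqNgt.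
    by rewrite (leq_ltn_trans jk kt).
  rewrite (nneseries_split 0 t)// add0n [X in (_ + X)%E]eseries0 ?adde0; last first.
    by move=> i ti _; rewrite aliveE ltnNge ti.
  rewrite (eq_big_nat _ _ (F2 := fun=> 1%E)); last first.
    by move=> i /andP[_ it]; rewrite aliveE it.
  rewrite sumEFin sumr_const_nat subn0; apply/eqP; rewrite eq_le; apply/andP; split.
    by apply: ereal_inf_lbound; exists t.
  by apply: le_ereal_inf_tmp => _ [k /= Xk <-]; rewrite lee_fin ler_nat tmin.
rewrite /hitting_time (_ : [set _ | _ in _] = set0); last first.
  by apply/seteqP; split=> x //= [k Xk _]; case: nX; exists k.
rewrite ereal_inf0; apply/esym/eqyP => r r0.
apply: le_trans (nneseries_lim_ge (Num.trunc r).+1 (fun n _ _ => ind_ge0 n)).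
rewrite (eq_big_nat _ _ (F2 := fun=> 1%E)); last first.
  move=> i _; rewrite indicE mem_set// => k _; apply/negP => Xk.
  by apply: nX; exists k.
by rewrite sumEFin sumr_const_nat subn0 lee_fin ltW// truncnS_gt.
Qed.

Lemma expectation_hitting_time :
  (\int[P]_v tau v = \sum_(0 <= n <oo) (survival n)%:E)%E.
Proof.
rewrite (eq_integral (fun w => \sum_(0 <= n <oo) (\1_(alive n) w)%:E)%E); last first.
  by move=> w _; exact: hitting_time_sum.
rewrite integral_nneseries//; last first.
  move=> n; apply/measurable_EFinP; apply: measurable_indic.
  exact: measurable_alive.
apply: eq_eseriesr => n _; rewrite integral_indic//; last exact: measurable_alive.
by rewrite setIT fineK//; exact: fin_num_measure (measurable_alive n).
Qed.

Lemma hitting_time_cdf (r : R) : 0 <= r ->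
  P [set w | (tau w <= r%:E)%E] = (1 - survival (Num.trunc r))%:E.
Proof.
move=> r0; rewrite EFinB fineK; last exact: fin_num_measure (measurable_alive _).
rewrite -probability_setC; last exact: measurable_alive.
congr (P _); apply/seteqP; split => w /=.
  move=> wr Aw; move: wr; apply/negP; rewrite -ltNge.
  apply: (@lt_le_trans _ _ (Num.trunc r).+1%:R%:E).
    by rewrite lte_fin truncnS_gt.
  apply: le_ereal_inf_tmp => _ [k /= Xk <-].
  rewrite lee_fin ler_nat ltnNge; apply/negP => kn.
  by have := Aw k kn; rewrite Xk.
move=> /alive_hitting_time/negP; rewrite -leNgt => /le_trans; apply.
by rewrite lee_fin truncn_le.
Qed.

End Killed.

(** * Two test functions for the walk in a well *)

Section Barriers.
Context {R : realType}.
Variables (r : R) (N : nat).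
Hypotheses (r01 : 0 < r < 1) (N0 : (0 < N)%N).

(** The probability of a jump along the drift; parametrizing by the ratio [r]
    of the two jump probabilities makes the identities below rational in
    [r] and its powers. *)
Definition drift_prob : R := (1 + r)^-1.
(** The inverse of the drift [2 * drift_prob - 1]: away from the turning
    points a function of slope [slope] changes by 1 in mean. *)
Definition slope : R := (1 + r) / (1 - r).
(** The constant is fixed by [scale_pred], the balance of the slopes of
    [upper_barrier] at the bottom of the well. *)
Definition scale : R := 2 * r * (1 + r) / (1 - r) ^+ 2 / r ^+ N.

(** Sites are numbered by their distance [j] to the target at the rim of the
    relevant well: the targets are [j = 0] and [j = 4 * N], the bottom of the
    well is [j = N], the start [j = 2 * N], and [j = 3 * N] is the top of the
    ridge that separates the well from the other target. *)
Definition down_prob j : R :=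
  if (N <= j <= 3 * N)%N then drift_prob else 1 - drift_prob.

Definition step_mean (f : nat -> R) j : R :=
  down_prob j * f j.-1 + (1 - down_prob j) * f j.+1.

(** For [j <= 3 * N] this is the expected time to hit 0 if the drift towards
    [N] persisted on the whole half-line beyond [N]: it solves [Q U = U - 1].
    Its leading order for [j <= N] is the harmonic function
    [scale * (1 - r ^+ j)]. Beyond the ridge it turns around linearly, which
    keeps it nonnegative up to [4 * N]; the concave kink at [3 * N] has the
    favourable sign. *)
Definition upper_barrier j : R :=
  if (j <= N)%N then scale * (1 - r ^+ j) - slope * j%:R
  else if (j <= 3 * N)%N then scale * (1 - r ^+ N) + slope * (j%:R - (2 * N)%:R)
  else scale * (1 - r ^+ N) + slope * ((4 * N)%:R - j%:R).

Let r0 : 0 < r. Proof. by case/andP: r01. Qed.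
Let r1 : r < 1. Proof. by case/andP: r01. Qed.
Let rn0 : r != 0. Proof. by rewrite gt_eqF. Qed.
Let r1n0 : 1 + r != 0.
Proof. by have h : 0 < 1 + r; [have := r01; lra | rewrite gt_eqF]. Qed.
Let r1n1 : 1 - r != 0.
Proof. by have h : 0 < 1 - r; [have := r01; lra | rewrite gt_eqF]. Qed.
Let rX n : 0 < r ^+ n. Proof. exact: exprn_gt0. Qed.
Let rXle1 n : r ^+ n <= 1. Proof. by rewrite exprn_ile1// ltW. Qed.

Lemma drift_prob01 : 0 <= drift_prob <= 1.
Proof. by rewrite /drift_prob invr_ge0 invf_le1; have := r01; lra. Qed.

Lemma down_prob01 j : 0 <= down_prob j <= 1.
Proof. by have := drift_prob01; rewrite /down_prob; case: ifP => _; lra. Qed.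

Lemma slope_ge1 : 1 <= slope.
Proof. by rewrite /slope ler_pdivlMr; have := r01; lra. Qed.

Lemma slope_ge0 : 0 <= slope.
Proof. exact: le_trans ler01 slope_ge1. Qed.

Lemma scale_gt0 : 0 < scale.
Proof.
by rewrite /scale !mulr_gt0 ?invr_gt0 ?exprn_gt0// ?subr_gt0//; have := r01; lra.
Qed.

Lemma scale_pred : scale * r ^+ N.-1 * (1 - r) = 2 * slope.
Proof.
rewrite /scale /slope; case: N N0 => [//|n] _; rewrite [r ^+ n.+1]exprS /=.
by field; rewrite r1n1 rn0 gt_eqF.
Qed.

Lemma upper_barrier_near j : (j <= N)%N ->
  upper_barrier j = scale * (1 - r ^+ j) - slope * j%:R.
Proof. by rewrite /upper_barrier => ->. Qed.

Lemma upper_barrier_middle j : (N <= j <= 3 * N)%N ->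
  upper_barrier j = scale * (1 - r ^+ N) + slope * (j%:R - (2 * N)%:R).
Proof.
move=> /andP[Nj j3]; rewrite /upper_barrier j3; case: leqP => // jN.
have -> : j = N by apply/eqP; rewrite eqn_leq jN.
by rewrite natrM; ring.
Qed.

Lemma upper_barrier_far j : (3 * N <= j)%N ->
  upper_barrier j = scale * (1 - r ^+ N) + slope * ((4 * N)%:R - j%:R).
Proof.
move=> j3; have [jN|Nj] := leqP j (3 * N); last first.
  by rewrite /upper_barrier !ifF //; apply/negbTE; rewrite -ltnNge; lia.
have -> : j = (3 * N)%N by apply/eqP; rewrite eqn_leq jN.
by rewrite upper_barrier_middle ?leqnn ?andbT; [rewrite !natrM; ring | lia].
Qed.

Lemma upper_barrier_mean j : (0 < j < 3 * N)%N ->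
  step_mean upper_barrier j = upper_barrier j - 1.
Proof.
case: j => [//|j] /andP[_ j3]; rewrite /step_mean /down_prob /=.
case: (ltngtP j.+1 N) => [jN|Nj|jN].
- rewrite !upper_barrier_near ?(ltnW jN)//; last by lia.
  rewrite !exprS -!natr1 /drift_prob /slope /=.
  by field; rewrite r1n0 r1n1.
- rewrite (ltnW j3) !upper_barrier_middle; try lia.
  rewrite -!natr1 /drift_prob /slope /=.
  by field; rewrite r1n0 r1n1.
- rewrite (ltnW j3) upper_barrier_near; last by lia.
  rewrite !upper_barrier_middle -?jN; try lia.
  rewrite /scale -jN !natrM [r ^+ j.+1]exprS -!natr1 /drift_prob /slope /=.
  by field; rewrite r1n0 r1n1 rn0 gt_eqF//= rX.
Qed.

Lemma upper_barrier_mean_le j : (0 < j)%N ->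
  step_mean upper_barrier j <= upper_barrier j - 1.
Proof.
have [j3|j3] := ltnP j (3 * N).
  by move=> j0; rewrite upper_barrier_mean ?j0.
case: j j3 => [//|j] j3 _; rewrite /step_mean /down_prob /=.
have s1 := slope_ge1.
have [jn3|jn3] := eqVneq j.+1 (3 * N)%N.
  rewrite jn3 leqnn andbT (_ : (N <= 3 * N)%N); last by lia.
  rewrite upper_barrier_middle; last by lia.
  rewrite !upper_barrier_far; try lia.
  have -> : j%:R = 3 * N%:R - 1 :> R.
    by rewrite -natrM -jn3 -natr1 addrK.
  rewrite -[(3 * N).+1%:R]natr1 !natrM.
  by have := drift_prob01; nra.
rewrite (_ : (j.+1 <= 3 * N)%N = false) ?andbF; last by lia.
rewrite !upper_barrier_far; try lia.
rewrite le_eqVlt; apply/orP; left; apply/eqP.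
rewrite -!natr1 /drift_prob /slope /=.
by field; rewrite r1n0 r1n1.
Qed.

Lemma upper_barrier_ge0 j : (j <= 4 * N)%N -> 0 <= upper_barrier j.
Proof.
move=> j4.
have near k : (k <= N)%N -> 0 <= scale * (1 - r ^+ k) - slope * k%:R.
  elim: k => [|k IH] kN; first by rewrite expr0 subrr !mulr0 subrr.
  apply: le_trans (IH (ltnW kN)) _; rewrite -subr_ge0 exprS -natr1.
  rewrite [leRHS](_ : _ = scale * r ^+ k * (1 - r) - slope); last by ring.
  rewrite subr_ge0.
  apply: (@le_trans _ _ (scale * r ^+ N.-1 * (1 - r))).
    by rewrite scale_pred; have := slope_ge1; lra.
  rewrite ler_pM2r ?subr_gt0// ler_pM2l ?scale_gt0//.
  by apply: ler_wiXn2l; lia || (have := r01; lra).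
have s1 := slope_ge1.
have [jN|Nj] := leqP j N; first by rewrite upper_barrier_near// near.
have [j3|j3] := leqP j (3 * N).
  rewrite upper_barrier_middle ?j3 ?(ltnW Nj)//.
  have := near N (leqnn N).
  have : N%:R <= j%:R :> R by rewrite ler_nat ltnW.
  by rewrite natrM; nra.
rewrite upper_barrier_far ?(ltnW j3)// addr_ge0//.
  by rewrite mulr_ge0 ?subr_ge0 ?rXle1// ltW// scale_gt0.
by rewrite mulr_ge0 ?subr_ge0 ?ler_nat//; lra.
Qed.

Lemma upper_barrier_start : upper_barrier (2 * N) <= scale.
Proof.
rewrite upper_barrier_middle; last by lia.
by rewrite subrr mulr0 addr0 ler_piMr ?(ltW scale_gt0)// gerBl ltW.
Qed.

Variable e : R.

(** The tilt that makes [lower_barrier] vanish at the ridge [3 * N]. In terms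
    of the distance [y] to the ridge the harmonic function is [r ^+ y]; the
    factor [y + 1] turns it into a strictly superharmonic one, whose surplus
    [(1 - r) / (1 + r) * r ^+ y] absorbs the term [rate * far_penalty]
    ([far_penalty_mean]). *)
Definition far_penalty j : R := (3 * N - j).+1%:R * r ^+ (3 * N - j).

(** Normalized [upper_barrier], lowered slightly: its deficit [1 / scale] per
    step is below [rate * tilted] wherever [tilted] is close to 1. *)
Definition tilted j : R := upper_barrier j / scale - e * (1 - e).

(** Harmonic between the target and the bottom of the well, hence usable
    where [tilted] is too small. The constants [e * (1 - e)] and [1 - e] are
    matched so that [tilted] can exceed [escape] only where [1 - r ^+ j >= 1
    - e], that is, only where [tilted] is still at least [(1 - e) ^+ 2]. *)
Definition escape j : R := (1 - e) * (1 - r ^+ j).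

(** A maximum of functions [f] with [Q f >= (1 - rate) f] inherits this
    property at each point where the maximizing function has it; the pieces
    are chosen such that this is always the case. *)
Definition lower_barrier j : R :=
  if (j < N)%N then Num.max (tilted j) (escape j)
  else if (j <= 3 * N)%N then Num.max 0 (tilted j - far_penalty j)
  else 0.

(** The factor [(1 - e) ^- 2] pays for [tilted] being only at least [(1 - e)
    ^+ 2], and [1 + e] for the jump of [far_penalty N] across the bottom of
    the well. *)
Definition rate : R := (1 + e) / (1 - e) ^+ 2 / scale.

(** Apart from the range of [e], each condition bounds a quantity of order at
    most [N * r ^+ N]. *)
Definition negligible_errors : Prop :=
  [/\ 0 < e <= 4^-1,
      r ^+ N + slope * N%:R / scale + far_penalty N <= e ^+ 2,
      scale * far_penalty N <= e,
      rate * (2 * N).+1%:R <= (1 - r) / (1 + r) &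
      (N + 2)%:R * r ^+ N <= e].

Let sc0 := scale_gt0.

Lemma far_penalty_ge0 j : 0 <= far_penalty j.
Proof. by rewrite mulr_ge0// ltW. Qed.

Let slope_term_ge0 j : 0 <= slope * j%:R / scale.
Proof. exact: divr_ge0 (mulr_ge0 slope_ge0 (ler0n _ _)) (ltW sc0). Qed.

Lemma tilted_step_mean f j : step_mean (fun i => tilted i - f i) j =
  step_mean upper_barrier j / scale - e * (1 - e) - step_mean f j.
Proof. by rewrite /step_mean /tilted; ring. Qed.

Lemma escape_mean j : (0 < j < N)%N -> step_mean escape j = escape j.
Proof.
case: j => [//|j] /andP[_ jN]; rewrite /step_mean /down_prob leqNgt jN /=.
by rewrite /escape !exprS /drift_prob; field; rewrite r1n0.
Qed.

Lemma far_penalty_mean j : (N <= j < 3 * N)%N ->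
  step_mean far_penalty j = far_penalty j - (1 - r) / (1 + r) * r ^+ (3 * N - j).
Proof.
case: j => [|j] /andP[Nj j3]; first by have := N0; lia.
rewrite /step_mean /down_prob Nj (ltnW j3) /= /far_penalty.
have [y yE] : exists y, (3 * N = j + y.+2)%N by exists (3 * N - j.+2)%N; lia.
have -> : (3 * N - j = y.+2)%N by lia.
have -> : (3 * N - j.+1 = y.+1)%N by lia.
have -> : (3 * N - j.+2 = y)%N by lia.
by rewrite !exprS -!natr1 /drift_prob; field; rewrite r1n0.
Qed.

Lemma tilted_near j : (j <= N)%N ->
  tilted j = 1 - r ^+ j - slope * j%:R / scale - e * (1 - e).
Proof.
by move=> jN; rewrite /tilted upper_barrier_near//; field; rewrite gt_eqF.
Qed.

Lemma tilted_middle j : (N <= j <= 3 * N)%N ->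
  tilted j = 1 - r ^+ N + slope * (j%:R - (2 * N)%:R) / scale - e * (1 - e).
Proof.
by move=> jN; rewrite /tilted upper_barrier_middle//; field; rewrite gt_eqF.
Qed.

Lemma slope_dist_ge j : (N <= j)%N ->
  - (slope * N%:R / scale) <= slope * (j%:R - (2 * N)%:R) / scale.
Proof.
move=> Nj; rewrite -mulNr -mulrN ler_pM2r ?invr_gt0//.
have s1 := slope_ge1; rewrite ler_pM2l; last by lra.
have : N%:R <= j%:R :> R by rewrite ler_nat.
by rewrite natrM; lra.
Qed.

Lemma slope_dist_le j : (j <= 3 * N)%N ->
  slope * (j%:R - (2 * N)%:R) / scale <= slope * N%:R / scale.
Proof.
move=> j3; rewrite ler_pM2r ?invr_gt0//.
have s1 := slope_ge1; rewrite ler_pM2l; last by lra.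
have : j%:R <= (3 * N)%:R :> R by rewrite ler_nat.
by rewrite !natrM; lra.
Qed.

Hypothesis small : negligible_errors.

Lemma error_bounds : 0 < e <= 4^-1. Proof. by case: small. Qed.

Lemma near_error_le : r ^+ N + slope * N%:R / scale + far_penalty N <= e ^+ 2.
Proof. by case: small. Qed.

Lemma tilted_far_end : tilted (3 * N) - far_penalty (3 * N) <= 0.
Proof.
rewrite /tilted /far_penalty subnn expr0 mulr1 upper_barrier_far//.
have -> : (4 * N)%:R - (3 * N)%:R = N%:R :> R by rewrite -natrB; [congr _%:R; lia | lia].
rewrite mulrDl [scale * _]mulrC mulfK ?gt_eqF//.
have := near_error_le; have := far_penalty_ge0 N; have := rX N; have := error_bounds; nra.
Qed.

Lemma lower_barrier_ge0 j : 0 <= lower_barrier j.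
Proof.
rewrite /lower_barrier; case: ifP => _; last first.
  by case: ifP => // _; rewrite le_max lexx.
by rewrite le_max mulr_ge0 ?subr_ge0 ?rXle1 ?orbT//; have := error_bounds; lra.
Qed.

Lemma tilted_le_lower_barrier j : (j <= 3 * N)%N ->
  tilted j - far_penalty j <= lower_barrier j.
Proof.
move=> j3; rewrite /lower_barrier; case: ifP => _.
  by rewrite le_max gerBl far_penalty_ge0.
by rewrite j3 le_max lexx orbT.
Qed.

(** The case that matters is [j = N]: there [lower_barrier] switches to
    [tilted], which must dominate [escape] in spite of the penalty. *)
Lemma escape_le_lower_barrier j : (j <= N)%N -> escape j <= lower_barrier j.
Proof.
rewrite leq_eqVlt => /predU1P[->|jN]; last first.
  by rewrite /lower_barrier jN le_max lexx orbT.
apply: le_trans (tilted_le_lower_barrier _); last by lia.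
rewrite tilted_near// /escape.
have := near_error_le; have := rX N; have := error_bounds; nra.
Qed.

Lemma step_mean_ge0 f j : (forall i, 0 <= f i) -> 0 <= step_mean f j.
Proof.
move=> f0; rewrite /step_mean addr_ge0// mulr_ge0//; have := down_prob01 j; lra.
Qed.

Lemma ler_step_mean f g j : f j.-1 <= g j.-1 -> f j.+1 <= g j.+1 ->
  step_mean f j <= step_mean g j.
Proof.
move=> fg fg'; rewrite /step_mean lerD// ler_wpM2l//; have := down_prob01 j; lra.
Qed.

Lemma rate_ge0 : 0 <= rate.
Proof.
by rewrite !mulr_ge0 ?invr_ge0 ?(ltW sc0)// ?exprn_ge0//; have := error_bounds; lra.
Qed.

Lemma rate_tilted x : (1 - e) ^+ 2 <= x -> (1 + e) / scale <= rate * x.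
Proof.
move=> ex; apply: le_trans (ler_wpM2l rate_ge0 ex).
have e1 : 0 < (1 - e) ^+ 2 by rewrite exprn_gt0//; have := error_bounds; lra.
by rewrite /rate mulrAC divfK ?gt_eqF.
Qed.

Let upper_scaleB j :
  (upper_barrier j - 1) / scale = upper_barrier j / scale - scale^-1.
Proof. by rewrite mulrBl mul1r. Qed.

(** At [j = N] the neighbour [N.-1] lies on the other side of the bottom, where
    [lower_barrier] still dominates the penalized [tilted]. *)
Lemma lower_barrier_middle_mean j : (N <= j < 3 * N)%N ->
  (1 - rate) * (tilted j - far_penalty j) <= step_mean lower_barrier j.
Proof.
move=> jN; have jN' : (N <= j <= 3 * N)%N by lia.
have j0 : (0 < j < 3 * N)%N by lia.
have y2N : ((3 * N - j).+1 <= (2 * N).+1)%N by lia.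
have [_ _ _ rate_small _] := small.
apply: (@le_trans _ _ (step_mean (fun i => tilted i - far_penalty i) j)); last first.
  by apply: ler_step_mean; apply: tilted_le_lower_barrier; clear -jN; lia.
rewrite tilted_step_mean upper_barrier_mean// far_penalty_mean//.
have : (1 - e) ^+ 2 <= tilted j.
  rewrite tilted_middle//; case/andP: jN => Nj _.
  have := slope_dist_ge Nj; have := near_error_le; have := far_penalty_ge0 N.
  by have := rX N; have := error_bounds; nra.
move=> /rate_tilted; rewrite /tilted mulrDl mul1r => tj.
have : rate * far_penalty j <= (1 - r) / (1 + r) * r ^+ (3 * N - j).
  rewrite /far_penalty mulrA ler_pM2r//; apply: le_trans rate_small.
  by rewrite ler_wpM2l ?rate_ge0// ler_nat.
rewrite upper_scaleB.
have : 0 <= e / scale.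
  by apply: divr_ge0; [have := error_bounds; lra | exact: ltW sc0].
by move: tj; lra.
Qed.

Lemma escape_phase_mean j : (0 < j < N)%N ->
  (1 - rate) * escape j <= step_mean lower_barrier j.
Proof.
move=> jN; have jN1 : (j.+1 <= N)%N by lia.
have jN2 : (j.-1 <= N)%N by lia.
apply: (@le_trans _ _ (escape j)).
  have := rate_ge0; rewrite /escape; have := error_bounds; have := rXle1 j.
  by move=> ? ? ?; rewrite ler_piMl//; [rewrite mulr_ge0 ?subr_ge0//; lra | lra].
by rewrite -escape_mean//; apply: ler_step_mean; exact: escape_le_lower_barrier.
Qed.

(** The bottom of the well is the only possible neighbour that carries a
    penalty, so it suffices to lower [tilted] by [far_penalty N]. *)
Lemma tilted_phase_mean j : (0 < j < N)%N -> escape j <= tilted j ->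
  (1 - rate) * tilted j <= step_mean lower_barrier j.
Proof.
move=> jN et; have jN1 : (j < N)%N by lia.
have jN2 : (j.-1 < N)%N by lia.
have j3 : (0 < j < 3 * N)%N by lia.
have NN : (N <= 3 * N)%N by lia.
have [_ _ penalty_small _ _] := small.
apply: (@le_trans _ _ (step_mean (fun i => tilted i - far_penalty N) j)); last first.
  have le_bar i : (i < N)%N -> tilted i - far_penalty N <= lower_barrier i.
    by move=> iN; rewrite /lower_barrier iN le_max gerBl far_penalty_ge0.
  apply: ler_step_mean; first exact: le_bar.
  move: jN1; rewrite leq_eqVlt => /predU1P[->|]; last exact: le_bar.
  exact: tilted_le_lower_barrier.
rewrite tilted_step_mean upper_barrier_mean// upper_scaleB.
rewrite [step_mean (fun=> _) _](_ : _ = far_penalty N); last by rewrite /step_mean; ring.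
have : (1 - e) ^+ 2 <= tilted j.
  move: (et); rewrite tilted_near ?(ltnW jN1)// /escape.
  by have := slope_term_ge0 j; have := rX j; have := error_bounds; nra.
move=> /rate_tilted; rewrite /tilted mulrDl mul1r => tj.
have : far_penalty N <= e / scale by rewrite ler_pdivlMr// mulrC.
by move: tj; lra.
Qed.

Lemma lower_barrier_mean j : (0 < j < 4 * N)%N ->
  (1 - rate) * lower_barrier j <= step_mean lower_barrier j.
Proof.
move=> /andP[j0 j4].
have pos : 0 <= step_mean lower_barrier j.
  by apply: step_mean_ge0 => i; exact: lower_barrier_ge0.
have [jN|Nj] := ltnP j N.
  rewrite [lower_barrier j]/lower_barrier jN.
  have [te|/ltW et] := leP (tilted j) (escape j).
    by apply: escape_phase_mean; rewrite j0.
  by apply: tilted_phase_mean; rewrite ?j0.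
rewrite [lower_barrier j]/lower_barrier ltnNge Nj /=.
case: leqP => [j3|_]; last by rewrite mulr0.
case: (leP (tilted j - far_penalty j) 0) => [le0|gt0]; first by rewrite mulr0.
apply: lower_barrier_middle_mean; rewrite Nj ltn_neqAle j3 andbT.
by apply/eqP => jE; move: gt0; rewrite jE ltNge tilted_far_end.
Qed.

Lemma lower_barrier_le1 j : lower_barrier j <= 1.
Proof.
have := error_bounds => e1; rewrite /lower_barrier; case: ifPn => [jN|Nj].
  rewrite ge_max /escape; apply/andP; split.
    rewrite tilted_near ?(ltnW jN)//.
    by have := slope_term_ge0 j; have := rX j; nra.
  by have := rX j; have := rXle1 j; nra.
case: ifP => // j3; rewrite ge_max ler01/= tilted_middle ?j3; last by rewrite leqNgt Nj.
have := slope_dist_le j3; have := far_penalty_ge0 j.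
have := near_error_le; have := rX N; have := far_penalty_ge0 N; nra.
Qed.

Lemma lower_barrier_target j : (j == 0) || (j == 4 * N)%N -> lower_barrier j <= 0.
Proof.
have := error_bounds => e1; case/orP => /eqP ->; rewrite /lower_barrier.
  rewrite N0 ge_max tilted_near// /escape expr0 subrr !mulr0 mul0r subr0 sub0r.
  by rewrite lexx andbT oppr_le0; apply: mulr_ge0; lra.
by rewrite !ifF //; apply/negbTE; rewrite -?leqNgt -?ltnNge; have := N0; lia.
Qed.

Lemma lower_barrier_start : 1 - 2 * e <= lower_barrier (2 * N).
Proof.
apply: le_trans (tilted_le_lower_barrier _); last by lia.
rewrite tilted_middle; last by lia.
rewrite subrr mulr0 mul0r addr0 /far_penalty.
have -> : (3 * N - 2 * N = N)%N by lia.
have [_ _ _ _] := small; rewrite natrD -natr1; have := error_bounds; nra.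
Qed.

End Barriers.

(** * Asymptotics in the size of the well *)

Section Asymptotics.
Context {R : realType}.

(** With [s := sqrt r], the product [N.+1 * s ^+ N] is bounded by the sum of
    the geometric series of ratio [s], and another factor [s ^+ N] remains. *)
Lemma cvg_linear_geometric (r : R) : 0 < r -> r < 1 ->
  N.+1%:R * r ^+ N @[N --> \oo] --> 0.
Proof.
move=> r0 r1; pose s := Num.sqrt r.
have ss : s * s = r by rewrite -expr2 sqr_sqrtr// ltW.
have s0 : 0 < s by rewrite sqrtr_gt0.
have s1 : s < 1 by nra.
have bound N : N.+1%:R * s ^+ N <= (1 - s)^-1.
  apply: (@le_trans _ _ (series (geometric 1 s) N.+1)).
    rewrite mulr_natl -[X in _ *+ X]subn0 -sumr_const_nat.
    apply: ler_sum_nat => i /andP[_ iN]; rewrite /geometric /= mul1r.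
    by apply: ler_wiXn2l; rewrite ?ltW.
  rewrite geometric_seriesE /=; last by rewrite lt_eqF.
  by rewrite mul1r ler_piMl ?invr_ge0 ?subr_ge0 ?(ltW s1)// gerBl exprn_ge0// ltW.
apply: (@squeeze_cvgr _ _ _ _ (fun=> 0) (fun N => (1 - s)^-1 * s ^+ N)).
- apply: nearW => N; rewrite mulr_ge0 ?exprn_ge0 ?(ltW r0)//=.
  have -> : r ^+ N = s ^+ N * s ^+ N by rewrite -exprMn ss.
  by rewrite mulrA ler_pM2r// exprn_gt0.
- exact: cvg_cst.
- rewrite -[0](mulr0 (1 - s)^-1); apply: cvgM; first exact: cvg_cst.
  by apply: cvg_expr; rewrite ger0_norm ?(ltW s0).
Qed.

Lemma near_linear_geometric_le (r d : R) : 0 < r < 1 -> 0 < d ->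
  \forall N \near \oo, N.+1%:R * r ^+ N <= d.
Proof.
by move=> /andP[r0 r1] d0; exact: (cvgr_le _ (cvg_linear_geometric r0 r1)).
Qed.

Lemma scale_cvgy (r : R) : 0 < r < 1 -> scale r N @[N --> \oo] --> +oo.
Proof.
move=> r01; have /andP[r0 r1] := r01.
pose c := 2 * r * (1 + r) / (1 - r) ^+ 2.
have c0 : 0 < c by rewrite /c divr_gt0 ?exprn_gt0 ?subr_gt0//; nra.
apply/cvgryPge => M.
have d0 : 0 < c / (`|M| + 1) by rewrite divr_gt0// ltr_pwDr.
near=> N.
have rN : 0 < r ^+ N by rewrite exprn_gt0.
rewrite /scale -/c ler_pdivlMr//.
have : N.+1%:R * r ^+ N <= c / (`|M| + 1).
  by near: N; exact: near_linear_geometric_le.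
rewrite ler_pdivlMr; last by rewrite ltr_pwDr.
have M1 := ler_norm M; have M0 := normr_ge0 M.
apply: le_trans; rewrite -natr1 -mulrA.
have n0 : 0 <= N%:R * (r ^+ N * (`|M| + 1)).
  by rewrite !mulr_ge0// ?(ltW rN)// addr_ge0.
have Mr : M * r ^+ N <= `|M| * r ^+ N by rewrite ler_pM2r.
rewrite mulrDl mul1r mulrDr mulr1; lra.
Unshelve. all: by end_near. Qed.

Lemma negligible_errors_near (r e : R) : 0 < r < 1 -> 0 < e <= 4^-1 ->
  \forall N \near \oo, negligible_errors r N e.
Proof.
move=> r01 e01; have /andP[r0 r1] := r01; have /andP[e0 e4] := e01.
pose c := 2 * r * (1 + r) / (1 - r) ^+ 2.
have c0 : 0 < c by rewrite /c divr_gt0 ?exprn_gt0 ?subr_gt0//; nra.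
have s0 : 0 <= slope r by exact: slope_ge0.
pose C := (1 + e) / (1 - e) ^+ 2.
have C0 : 0 < C by rewrite /C divr_gt0 ?exprn_gt0//; lra.
have sc : 0 <= slope r / c by rewrite divr_ge0// ltW.
have d0 : 0 < 3 + slope r / c by lra.
have d1 : 0 < e ^+ 2 / (3 + slope r / c) by rewrite divr_gt0// exprn_gt0.
have d2 : 0 < e / (2 * c) by rewrite divr_gt0// mulr_gt0.
have d3' : 0 < 2 * C / c by rewrite divr_gt0// mulr_gt0.
have d3 : 0 < (1 - r) / (1 + r) / (2 * C / c).
  by apply: divr_gt0 => //; apply: divr_gt0; lra.
have d4 : 0 < e / 2 by lra.
near=> N.
have rN : 0 < r ^+ N by rewrite exprn_gt0.
have rN1 : r ^+ N <= 1 by rewrite exprn_ile1// ltW.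
have n0 : 0 <= N%:R :> R by [].
set u := N.+1%:R * r ^+ N.
have uE : u = N%:R * r ^+ N + r ^+ N by rewrite /u -natr1 mulrDl mul1r.
have lossE : far_penalty r N N = (2 * N%:R + 1) * (r ^+ N * r ^+ N).
  rewrite /far_penalty -exprD -natr1.
  have -> : (3 * N - N = N + N)%N by clear; lia.
  by rewrite natrD; congr ((_ + _) * _); ring.
have scE : scale r N * r ^+ N = c by rewrite /scale -/c divfK// gt_eqF.
have scV : (scale r N)^-1 = r ^+ N / c.
  by rewrite /scale -/c invf_div.
split=> //.
- have u1 : N.+1%:R * r ^+ N <= e ^+ 2 / (3 + slope r / c).
    by near: N; exact: near_linear_geometric_le r01 d1.
  move: u1; rewrite -/u ler_pdivlMr; last by rewrite ltr_wpDr// divr_ge0// ltW.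
  apply: le_trans; rewrite lossE scV.
  have -> : slope r * N%:R * (r ^+ N / c) = slope r / c * (N%:R * r ^+ N) by ring.
  rewrite uE; have : N%:R * r ^+ N * r ^+ N <= N%:R * r ^+ N.
    by rewrite ler_piMr// mulr_ge0// ltW.
  have : r ^+ N * r ^+ N <= r ^+ N by rewrite ler_piMr// ltW.
  have : 0 <= slope r / c * r ^+ N by rewrite mulr_ge0// ltW.
  have : 0 <= N%:R * r ^+ N by rewrite mulr_ge0// ltW.
  by nra.
- have u1 : N.+1%:R * r ^+ N <= e / (2 * c).
    by near: N; exact: near_linear_geometric_le r01 d2.
  move: u1; rewrite -/u ler_pdivlMr; last by rewrite mulr_gt0.
  apply: le_trans.
  rewrite lossE uE.
  have -> : scale r N * ((2 * N%:R + 1) * (r ^+ N * r ^+ N)) =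
    scale r N * r ^+ N * (2 * (N%:R * r ^+ N) + r ^+ N) by ring.
  by rewrite scE; have : 0 < c * r ^+ N by [rewrite mulr_gt0]; nra.
- have u1 : N.+1%:R * r ^+ N <= (1 - r) / (1 + r) / (2 * C / c).
    by near: N; exact: near_linear_geometric_le r01 d3.
  move: u1; rewrite -/u ler_pdivlMr//.
  apply: le_trans; rewrite /rate -/C scV uE -natr1 natrM.
  rewrite [leLHS](_ : _ = C / c * (2 * (N%:R * r ^+ N) + r ^+ N)); last by ring.
  rewrite [leRHS](_ : _ = C / c * (2 * (N%:R * r ^+ N) + 2 * r ^+ N)); last by ring.
  have Cc : 0 < C / c by exact: divr_gt0.
  by rewrite (ler_pM2l Cc) lerD2l [2 * _]mulr_natl mulr2n lerDl ltW.
- have u1 : N.+1%:R * r ^+ N <= e / 2.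
    by near: N; exact: near_linear_geometric_le r01 d4.
  by move: u1; rewrite -/u uE natrD mulrDl; nra.
Unshelve. all: by end_near. Qed.

(** The hypothesis that [t] is not an atom serves at [t = 0], where the
    interval [0, t] degenerates to a point. *)
Lemma std_exponential_cdf (t : R) : std_exponential R [set t] = 0%E ->
  std_exponential R `]-oo, t]%classic =
    (if 0 <= t then 1 - expR (- t) else 0)%:E.
Proof.
move=> t_null.
have neg (A : set R) : A `<=` [set x | x < 0] -> std_exponential R A = 0%E.
  move=> A0; rewrite std_exponentialE /exponential_prob; apply: integral0_eq => x /A0 x0.
  by rewrite lt0_exponential_pdf.
case: ifPn => [t0|]; last first.
  rewrite -ltNge => t0; apply: neg => x /=; rewrite in_itv /= => xt.
  exact: le_lt_trans t0.
have -> : `]-oo, t]%classic = `]-oo, 0[%classic `|` `[0, t]%classic :> set R.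
  apply/seteqP; split=> x /=; rewrite !in_itv /=; first by case: (ltP x 0); [left|right].
  by case=> [x0|/andP[]//]; exact: le_trans (ltW x0) t0.
rewrite measureU//; last first.
  by apply/seteqP; split=> x //= []; rewrite !in_itv /= => x0 /andP[]; rewrite leNgt x0.
rewrite [X in (X + _)%E](_ : _ = 0%E); last first.
  by apply: neg => x /=; rewrite in_itv.
rewrite add0e -[LHS]/(exponential_prob 1 `[0, t]%classic).
have [t1|] := ltP 0 t; first by rewrite exponential_prob_itv0c// mulN1r.
move=> t1; have t00 : t = 0 by apply/eqP; rewrite eq_le t1.
rewrite t00 set_itv1 oppr0 expR0 subrr.
  by move: t_null; rewrite t00.
Qed.

End Asymptotics.

(** * The alternating wells *)

Section Wells.
Context {R : realType}.
Variable theta : R.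

Definition well_ratio : R :=
  if theta < 2^-1 then theta / (1 - theta) else (1 - theta) / theta.

(** The distance to the target at the rim of the relevant well: [2N] when
    [theta < 1/2], where the drift near the origin points to the right, and
    [-2N] otherwise. *)
Definition well_depth N (x : state N) : nat :=
  if theta < 2^-1 then (4 * N - x)%N else x.

Lemma well_ratio01 : 0 < theta -> theta < 1 -> theta != 2^-1 ->
  0 < well_ratio < 1.
Proof.
move=> t0 t1 tn; rewrite /well_ratio; case: (ltgtP theta 2^-1) => [h|h|h].
- by rewrite divr_gt0 ?subr_gt0// ltr_pdivrMr; lra.
- by rewrite divr_gt0 ?subr_gt0// ltr_pdivrMr; lra.
- by rewrite h eqxx in tn.
Qed.

Lemma drift_prob_well_ratio : 0 < theta -> theta < 1 ->
  drift_prob well_ratio = if theta < 2^-1 then 1 - theta else theta.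
Proof.
move=> t0 t1; rewrite /drift_prob /well_ratio; case: ifP => _.
  by field; do ?[apply/andP; split]; apply/eqP; lra.
by field; do ?[apply/andP; split]; apply/eqP; lra.
Qed.

Lemma in_target N (x : state N) :
  (x \in target N) = ((x : nat) == 0) || ((x : nat) == 4 * N)%N.
Proof. by rewrite inE /site; have := ltn_ord x; lia. Qed.

Lemma well_depth_target N (x : state N) : x \in target N ->
  (well_depth x == 0) || (well_depth x == 4 * N)%N.
Proof.
by rewrite in_target /well_depth; case: ifP => _; have := ltn_ord x; lia.
Qed.

Lemma well_depth_inner N (x : state N) : x \notin target N ->
  (0 < well_depth x < 4 * N)%N.
Proof.
by rewrite in_target /well_depth; case: ifP => _; have := ltn_ord x; lia.
Qed.

Lemma well_depth_le N (x : state N) : (well_depth x <= 4 * N)%N.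
Proof. by rewrite /well_depth; case: ifP => _; have := ltn_ord x; lia. Qed.

Lemma well_depth_origin N : well_depth (origin N) = (2 * N)%N.
Proof. by rewrite /well_depth /origin inordK; last lia; case: ifP => _; lia. Qed.

Lemma alternating_wells_mean N (Q : state N -> state N -> R) (x : state N)
    (f : nat -> R) : alternating_wells theta Q -> x \notin target N ->
  \sum_y Q x y * f y =
    up_prob theta N (site x) * f x.+1 + (1 - up_prob theta N (site x)) * f x.-1.
Proof.
move=> [_ QE] xA; have := xA; rewrite in_target => xin.
have x4 := ltn_ord x.
have xS : (x.+1 < (4 * N).+1)%N by lia.
have xP : (x.-1 < (4 * N).+1)%N by lia.
have PS : Ordinal xP != Ordinal xS by apply/eqP => -[]; lia.
have upE (y : state N) : (site y == site x + 1) = ((y : nat) == x.+1).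
  by rewrite /site; lia.
have downE (y : state N) : (site y == site x - 1) = ((y : nat) == x.-1).
  by rewrite /site; lia.
rewrite (bigD1 (Ordinal xS))//= (bigD1 (Ordinal xP))//= big1; last first.
  move=> y /andP[yS yP]; rewrite QE// upE downE.
  by rewrite -!val_eqE/= in yS yP; rewrite (negbTE yS) (negbTE yP) mul0r.
rewrite !QE// !upE !downE /= eqxx addr0.
by rewrite (_ : x.-1 == x.+1 = false) ?eqxx//; lia.
Qed.

(** Both signs of [theta - 1/2] lead to the same walk in the distance to the
    relevant target. *)
Lemma step_mean_wells N (Q : state N -> state N -> R) (x : state N)
    (f : nat -> R) : 0 < theta -> theta < 1 ->
  alternating_wells theta Q -> x \notin target N ->
  \sum_y Q x y * f (well_depth y) = step_mean well_ratio N f (well_depth x).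
Proof.
move=> t0 t1 wQ xA; have := xA; rewrite in_target => xin.
have x4 := ltn_ord x.
rewrite /step_mean /down_prob drift_prob_well_ratio// /well_depth.
have upE : up_prob theta N (site x) = if (N <= x <= 3 * N)%N then 1 - theta else theta.
  rewrite /up_prob; congr (if _ then _ else _).
  by rewrite /site; lia.
case: (theta < 2^-1).
  rewrite [LHS](alternating_wells_mean (fun j => f (4 * N - j)%N) wQ xA).
  rewrite upE.
  have -> : ((4 * N - x).-1 = 4 * N - x.+1)%N by lia.
  have -> : ((4 * N - x).+1 = 4 * N - x.-1)%N by lia.
  have -> : (N <= 4 * N - x <= 3 * N)%N = (N <= x <= 3 * N)%N by lia.
  by case: ifP => _; ring.
rewrite (alternating_wells_mean f wQ xA) upE.
by case: ifP => _; ring.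
Qed.

End Wells.

Lemma series_survival (R : realType) (s : nat -> R) (K : R) :
  (forall i, 0 <= s i) -> (forall L, \sum_(0 <= i < L) s i <= K) ->
  [/\ series s @ \oo --> limn (series s), limn (series s) <= K,
      s 0 <= limn (series s) &
      (\sum_(0 <= i <oo) (s i)%:E = (limn (series s))%:E)%E].
Proof.
move=> s0 sK.
have nd : {homo series s : n m / (n <= m)%N >-> n <= m}.
  by apply/nondecreasing_seqP => n; rewrite /series /= big_nat_recr//= lerDl.
have cv : cvgn (series s).
  apply: nondecreasing_is_cvgn => //.
  by exists K => _ [n _ <-]; exact: sK.
split=> //.
- by apply: limr_le => //; apply: nearW => n; exact: sK.
- apply: le_trans (nondecreasing_cvgn_le nd cv 1%N).
  by rewrite /series /= big_nat1.
- apply/cvg_lim => //.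
  have -> : (fun n => (\sum_(0 <= i < n) (s i)%:E)%E) = EFin \o series s.
    by apply/funext => n /=; rewrite sumEFin.
  by apply: cvg_comp cv _.
Qed.

Theorem theorem7 (R : realType) (theta : R)
  (theta_gt0 : 0 < theta) (theta_lt1 : theta < 1) (theta_neq : theta != 2^-1)
  (d : nat -> measure_display) (T : forall N, measurableType (d N))
  (P : forall N, probability (T N) R)
  (Q : forall N, state N -> state N -> R)
  (X : forall N, nat -> T N -> state N)
  (wellsQ : forall N, (0 < N)%N -> alternating_wells theta (Q N))
  (chainX : forall N, (0 < N)%N ->
    markov_chain_from (P N) (Q N) (origin N) (X N)) :
  let tau N : T N -> \bar R := hitting_time R (X N) (target N) in
  cvg_in_distribution P
    (fun N w => (tau N w / \int[P N]_v tau N v)%E)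
    (std_exponential R).
Proof.
move=> tau t t_null; rewrite std_exponential_cdf//.
pose r := well_ratio theta.
have r01 : 0 < r < 1 by exact: well_ratio01.
pose S N := survival (P N) (X N) (target N).
pose m N := limn (series (S N)).
pose K N := scale r N.
have S_ge0 N i : 0 <= S N i by exact: fine_ge0.
have originA N : (0 < N)%N -> origin N \notin target N.
  by move=> N0; rewrite in_target /origin inordK; lia.
have Q_ge0 N : (0 < N)%N -> forall x y, 0 <= Q N x y.
  by move=> N0; have [[]] := wellsQ N N0.
have SK N : (0 < N)%N -> forall L, \sum_(0 <= i < L) S N i <= K N.
  move=> N0 L; pose U (x : state N) := upper_barrier r N (well_depth theta x).
  apply: (@le_trans _ _ (U (origin N))); last first.
    by rewrite /U well_depth_origin; exact: upper_barrier_start.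
  apply: (survival_sum_le (chainX N N0) (Q_ge0 N N0) (originA N N0)) => [x|x xA].
    by apply: upper_barrier_ge0 => //; exact: well_depth_le.
  rewrite (step_mean_wells _ theta_gt0 theta_lt1 (wellsQ N N0) xA).
  apply: upper_barrier_mean_le => //.
  by case/andP: (well_depth_inner theta xA).
have mP N : (0 < N)%N -> [/\ series (S N) @ \oo --> m N, m N <= K N,
    S N 0 <= m N & (\sum_(0 <= i <oo) (S N i)%:E = (m N)%:E)%E].
  by move=> N0; apply: series_survival; [exact: S_ge0 | exact: SK].
have lowS e : 0 < e -> e < 1 -> \forall N \near \oo, forall i,
    (1 - e) * (1 - (1 + e) / K N) ^+ i <= S N i.
  (* With f = e / 8 both 2 * f <= e and (1 + f) / (1 - f) ^+ 2 <= 1 + e. *)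
  move=> e0 e1; pose f := e / 8.
  have f01 : 0 < f <= 4^-1 by rewrite /f; apply/andP; split; lra.
  near=> N => i.
  have N0 : (0 < N)%N by near: N; exists 1%N.
  have small : negligible_errors r N f.
    by near: N; exact: negligible_errors_near.
  have K2 : 2 <= K N by near: N; exact: (cvgryPge _).1 (scale_cvgy r01) _.
  have K0 : 0 < K N by lra.
  have rate_le : rate r N f <= (1 + e) / K N.
    rewrite /rate ler_pM2r; last by rewrite invr_gt0.
    rewrite ler_pdivrMr; last first.
      by apply: exprn_gt0; rewrite /f; lra.
    by rewrite /f; nra.
  have eK : (1 + e) / K N <= 1 by rewrite ler_pdivrMr; lra.
  pose h (x : state N) := lower_barrier r N f (well_depth theta x).
  have rate1 : rate r N f <= 1 by exact: le_trans eK.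
  apply: (@le_trans _ _ (h (origin N) * (1 - rate r N f) ^+ i)); last first.
    apply: (survival_ge (chainX N N0) (Q_ge0 N N0) (originA N N0)) => //.
    - by move=> x; exact: (lower_barrier_le1 r01 small).
    - move=> x xA.
      exact: (lower_barrier_target r01 N0 small (well_depth_target theta xA)).
    - move=> x xA; rewrite (step_mean_wells _ theta_gt0 theta_lt1 (wellsQ N N0) xA).
      exact: (lower_barrier_mean r01 N0 small (well_depth_inner theta xA)).
  apply: ler_pM; [lra | by apply: exprn_ge0; lra | | ].
    rewrite /h well_depth_origin.
    apply: le_trans (lower_barrier_start r01 N0 small).
    by rewrite /f; lra.
  by apply: lerXn2r; rewrite ?nnegrE ?subr_ge0// lerB.
have m_gt0 N : (0 < N)%N -> 0 < m N.
  move=> N0; have [_ _ S0m _] := mP N N0; apply: lt_le_trans S0m.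
  rewrite /S (survival_sum (chainX N N0)).
  under eq_bigr do rewrite -[killed_law _ _ _ _ _]mulr1.
  by rewrite (killed_mean0 (chainX N N0) (originA N N0) (fun=> 1)) ltr01.
have rescale N : (0 < N)%N ->
    [set w | (tau N w / \int[P N]_v tau N v <= t%:E)%E]
    = [set w | (tau N w <= (t * m N)%:E)%E].
  move=> N0; have [_ _ _ mE] := mP N N0; have mN := m_gt0 N N0.
  apply/seteqP; rewrite /tau (expectation_hitting_time (chainX N N0)) mE.
  rewrite inver gt_eqF// EFinM.
  by split => w /=; rewrite lee_pdivrMr.
have [t0|t0] := leP 0 t; last first.
  apply: cvg_near_cst; near=> N.
  have N0 : (0 < N)%N by near: N; exists 1%N.
  rewrite rescale// (_ : [set w | _] = set0) ?measure0//.
  apply/seteqP; split=> w //=; apply/negP; rewrite -ltNge.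
  apply: (@lt_le_trans _ _ 0%E); first by rewrite lte_fin pmulr_llt0// m_gt0.
  by apply: le_ereal_inf_tmp => _ [k _ <-]; rewrite lee_fin.
have Scvg : S N (Num.trunc (t * m N)) @[N --> \oo] --> expR (- t).
  apply: (survival_cvg_expR (K := K)) => //.
  - near=> N; have N0 : (0 < N)%N by near: N; exists 1%N.
    exact: (survival_nonincreasing (chainX N N0)).
  - near=> N; have N0 : (0 < N)%N by near: N; exists 1%N.
    exact: (survival_le1 (chainX N N0)).
  - near=> N; have N0 : (0 < N)%N by near: N; exists 1%N.
    by have [] := mP N N0.
  - near=> N; have N0 : (0 < N)%N by near: N; exists 1%N.
    by have [] := mP N N0.
  - exact: scale_cvgy.
have cdfE : \forall N \near \oo, (1 - S N (Num.trunc (t * m N)))%:E =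
    P N [set w | (tau N w / \int[P N]_v tau N v <= t%:E)%E].
  near=> N; have N0 : (0 < N)%N by near: N; exists 1%N.
  rewrite rescale// (hitting_time_cdf (chainX N N0))//.
  by rewrite mulr_ge0// ltW// m_gt0.
apply: cvg_trans (near_eq_cvg cdfE) _.
by apply: cvg_comp (cvgB (cvg_cst _) Scvg) _.
Unshelve. all: by end_near. Qed.
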